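(* For every $d\in\mathbb N$ there exist constants $c_1(d)>0$ and $c_2(d)>0$, depending only on $d$, such that for every $\mathbf n=(n_1,\ldots,n_d)\in\mathbb N^d$ we have $$\Theta_m(\mathcal T(\mathbf n)_\infty,L_1[-\pi,\pi]^d)\ge c_2(d)>0\quad\text{whenever } m\le c_1(d)\,\frac{\prod_{j=1}^d n_j}{\max_{j}n_j}.$$
   Context: For $\mathbf n=(n_1,\ldots,n_d)\in\mathbb N^d$ (positive integers), $\mathcal T(\mathbf n)_\infty$ is the set of real trigonometric polynomials $$t(x)=\sum_{k\in\mathbb Z^d:\ |k_j|\le n_j,\ j=1,\ldots,d}c_k e^{i(k_1x_1+\ldots+k_dx_d)},\qquad c_{-k}=\overline{c_k},$$ with $\|t\|_\infty\le1$. For $X=\prod_{i=1}^d[a_i,b_i]$ and $f\in L_p(X)$, the error of best $m$-term approximation by tensor products is $$\Theta_m(f,L_p):=\inf_{u^{i,s}:[a_i,b_i]\to\mathbb R}\Big\|f-\sum_{s=1}^m u^{1,s}(x_1)\cdots u^{d,s}(x_d)\Big\|_{L_p(X)},$$ the infimum being over (measurable) functions $u^{i,s}$, $1\le i\le d$, $1\le s\le m$; and $\Theta_m(\mathcal F,L_p):=\sup_{f\in\mathcal F}\Theta_m(f,L_p)$ for a class $\mathcal F$ of functions. Here $m$ is a nonnegative integer, $X=[-\pi,\pi]^d$ and $p=1$. *)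

(* Defs.v *)
From HB Require Import structures.
From mathcomp Require Import all_boot all_order all_algebra.
From mathcomp Require Import all_classical all_reals all_analysis.
From mathcomp Require Import complex.

Set Implicit Arguments.
Unset Strict Implicit.
Unset Printing Implicit Defensive.

Import Order.TTheory GRing.Theory Num.Theory.

Local Open Scope classical_set_scope.
Local Open Scope ring_scope.

Notation euclid R d := (d.-tuple (measurableTypeR R)).

Section lebesgue_tuple.
Context {R : realType}.
Local Notation gR := (measurableTypeR R).
Local Open Scope ereal_scope.

Definition cons_pair d (p : gR * euclid R d) : euclid R d.+1 :=
  [tuple of p.1 :: p.2].

Lemma measurable_cons_pair d : measurable_fun setT (@cons_pair d).
Proof. exact: measurable_cons. Qed.

Definition uncons_pair d (x : euclid R d.+1) : gR * euclid R d :=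
  (thead x, [tuple of behead x]).

Lemma measurable_uncons_pair d : measurable_fun setT (@uncons_pair d).
Proof.
by apply/measurable_fun_pair; [exact: measurable_tnth|exact: measurable_behead].
Qed.

Lemma cons_pairK d : cancel (@cons_pair d) (@uncons_pair d).
Proof. by case=> x y; congr pair; exact/val_inj. Qed.

Section cons_measure.
Variables (d : nat) (m : {sigma_finite_measure set (euclid R d) -> \bar R}).

Definition cons_measure : set (euclid R d.+1) -> \bar R :=
  pushforward (@lebesgue_measure R \x m) (@cons_pair d).

Let cons_measure0 : cons_measure set0 = 0.
Proof. by rewrite /cons_measure /pushforward preimage_set0 measure0. Qed.

Let cons_measure_ge0 A : 0 <= cons_measure A.
Proof. by rewrite /cons_measure /pushforward; exact: measure_ge0. Qed.

Let cons_measure_sigma_additive : semi_sigma_additive cons_measure.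
Proof.
have mcons := @measurable_cons_pair d.
move=> F mF tF mUF; rewrite /cons_measure /pushforward preimage_bigcup.
apply: measure_semi_sigma_additive.
- by move=> n; rewrite -[X in measurable X]setTI; exact: mcons.
- apply/trivIsetP => /= i j _ _ ij; rewrite -preimage_setI.
  by move/trivIsetP : tF => /(_ _ _ _ _ ij) ->//; rewrite preimage_set0.
- by rewrite -preimage_bigcup -[X in measurable X]setTI; exact: mcons.
Qed.

HB.instance Definition _ := isMeasure.Build _ _ _ cons_measure
  cons_measure0 cons_measure_ge0 cons_measure_sigma_additive.

Lemma cons_measureX (A : set gR) (B : set (euclid R d)) :
  measurable A -> measurable B ->
  cons_measure (@uncons_pair d @^-1` (A `*` B)) = lebesgue_measure A * m B.
Proof.
move=> mA mB; rewrite /cons_measure /pushforward -comp_preimage.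
rewrite (_ : _ \o _ = id) ?preimage_id ?product_measure1E//.
by apply/funext => x; exact: cons_pairK.
Qed.

Let cons_measure_sigma_finite : sigma_finite setT cons_measure.
Proof.
have /sigma_finiteP[F [TF ndF Foo]] :=
  sigma_finiteT (@lebesgue_measure R : {sigma_finite_measure set gR -> \bar R}).
have /sigma_finiteP[G [TG ndG Goo]] := sigma_finiteT m.
exists (fun k => @uncons_pair d @^-1` (F k `*` G k)).
  rewrite -preimage_bigcup -(preimage_setT (@uncons_pair d)); congr (_ @^-1` _).
  rewrite -setXTT TF TG predeqE => -[x y]; split.
    move=> [/= [n _ Fnx] [k _ Gky]]; exists (maxn n k) => //; split.
    - by move: x Fnx; exact/subsetPset/ndF/leq_maxl.
    - by move: y Gky; exact/subsetPset/ndG/leq_maxr.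
  by move=> [n _ []/= ? ?]; split; exists n.
move=> k; have [mF Fk] := Foo k; have [mG Gk] := Goo k; split.
  rewrite -[X in measurable X]setTI; apply: measurable_uncons_pair => //.
  exact: measurableX.
by rewrite cons_measureX// lte_mul_pinfty// ge0_fin_numE.
Qed.

HB.instance Definition _ := Measure_isSigmaFinite.Build _ _ _ cons_measure
  cons_measure_sigma_finite.

End cons_measure.

(* $d$-dimensional Lebesgue measure: the $d$-fold product of the Lebesgue
   measure on $\mathbb R$, transported to tuples; unit mass at the unique
   point when $d = 0$. *)
Fixpoint lebesgue_tuple d : {sigma_finite_measure set (euclid R d) -> \bar R} :=
  if d is d'.+1 then cons_measure (lebesgue_tuple d')
  else \d_([tuple] : euclid R 0).

Lemma lebesgue_tuple_prod d (A : 'I_d -> set gR) :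
  (forall i, measurable (A i)) ->
  lebesgue_tuple d [set x | forall i, A i (tnth x i)] =
  \prod_(i < d) lebesgue_measure (A i).
Proof.
elim: d A => [|d IH] A mA.
  rewrite big_ord0 /= /dirac indicE mem_set//=.
  by case.
pose B : set (euclid R d) := [set y | forall i, A (lift ord0 i) (tnth y i)].
have mB : measurable B.
  rewrite (_ : B = \bigcap_(i in [set: 'I_d])
      (fun y => tnth y i) @^-1` A (lift ord0 i)); last first.
    by apply/seteqP; split => y /= yB i; [move=> _|]; exact: yB.
  apply: fin_bigcap_measurable => // i _.
  by rewrite -[X in measurable X]setTI; exact: measurable_tnth.
rewrite big_ord_recl -IH//= -cons_measureX//; congr (cons_measure _ _).
have behE (x : euclid R d.+1) (i : 'I_d) :
    tnth [tuple of behead x] i = tnth x (lift ord0 i).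
  by rewrite [in RHS](tuple_eta x) tnthS.
apply/seteqP; split => x /=.
  by move=> xA; split=> [|i]; [exact: xA|rewrite behE; exact: xA].
move=> [x0 xB] i; case: (unliftP ord0 i) => [j|] -> //.
by rewrite -behE; exact: xB.
Qed.

End lebesgue_tuple.

Section best_approximation.
Context {R : realType} (d : nat) (a b : 'I_d -> R).
Implicit Types (p : \bar R) (m : nat) (f : euclid R d -> R).

Definition box : set (euclid R d) :=
  [set x | forall i, tnth x i \in `[a i, b i]].

(* The function is extended by zero outside the box, so this is the norm of
   $L_p(\prod_i [a_i, b_i])$; for measurable f it is +oo when
   f is not in $L_p$. *)
Definition box_norm p f : \bar R :=
  'N[lebesgue_tuple d]_p [(EFin \o f) \_ box]%E.

Definition tensor_sum m (u : 'I_d -> 'I_m -> R -> R) (x : euclid R d) : R :=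
  \sum_(s < m) \prod_(i < d) u i s (tnth x i).

(* Every choice of measurable factors competes; those for which the difference
   is not in $L_p$ have distance +oo and do not affect the infimum. *)
Definition Theta m p f : \bar R :=
  ereal_inf [set box_norm p (f \- tensor_sum u) | u in
    [set u : 'I_d -> 'I_m -> R -> R |
      forall i s, measurable_fun `[a i, b i] (u i s)]].

Definition Theta_class m p (F : set (euclid R d -> R)) : \bar R :=
  ereal_sup [set Theta m p f | f in F].

End best_approximation.

Section trigonometric_polynomials.
Context {R : realType} (d : nat) (n : 'I_d -> nat).
Local Open Scope complex_scope.

Definition cis (theta : R) : R[i] := cos theta +i* sin theta.

Definition spectrum : set {ffun 'I_d -> int} :=
  [set k | forall j, `|k j| <= (n j)%:Z].

(* The coefficients are indexed by all of $\mathbb Z^d$; those outside the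
   (finite) spectrum play no role. *)
Definition trig_poly (t : euclid R d -> R) : Prop :=
  exists2 c : {ffun 'I_d -> int} -> R[i],
    forall k, c (- k) = (c k)^*
  & forall x, (t x)%:C =
      \sum_(k \in spectrum) c k * cis (\sum_(j < d) (k j)%:~R * tnth x j).

Definition trig_poly_ball : set (euclid R d -> R) :=
  [set t | trig_poly t /\ (box_norm (fun=> - pi)%R (fun=> pi)%R +oo t <= 1)%E].

End trigonometric_polynomials.

(* Main.v *)
Require Import Defs.
From HB Require Import structures.
From mathcomp Require Import all_boot all_order all_algebra.
From mathcomp Require Import boolp zify ring lra.



(** The hard functions are interpolants of sign patterns.  Take the grid with
    [n j] equispaced nodes along axis [j], so with [N = \prod_j n j] nodes in
    all, and for a sign pattern [e] on it put [f_e = \sum_g e_g B_g], where the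
    bump [B_g] is the tensor product of Fejer kernels of order [n j] centred at
    the node [g].  These are trigonometric polynomials of the right degree.
    The bumps are nonnegative and sum up to [1] ([fejer_partition],
    [sum_bump]), whence [`|f_e| <= 1]; and [B_g] is close to [1] near [g], so
    that [f_e] is close to [e_g] there ([interpolant_near]).

    Cut the integral over the cube into integrals over small boxes sitting at
    the nodes and move all of them to the origin
    ([box_norm1_ge_translates]): the L1 distance from [f_e] to a tensor sum
    with [m] terms is at least the integral, over small shifts [y], of the sum
    over the nodes [g] of the errors at [g + y].  For a fixed [y] the tensor
    sum is read only through its values on the shifted grid, which form an
    array of tensor rank at most [m].  It therefore suffices to find one sign
    pattern [e] from which every array of rank at most [m] stays away on a
    fixed proportion of the grid ([exists_inapproximable_pattern]).

    That pattern is obtained by a dimension count.  Suppose that every pattern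
    [e] has a good approximation [T_e] of rank at most [m].  There are then
    exponentially many patterns that are far apart in the Hamming distance and
    whose approximations fail on one and the same small set [S].  For such an
    [e] consider the polynomial [\prod_(g \notin S) (1 + e_g T_g) / 2] in the
    entries of the rank-one factors of [T].  It is nearly [1] at [T_e], and
    tiny at [T_e'] for any other pattern [e'] of the family, as it has many
    factors close to [0] there.  Hence these polynomials are linearly
    independent ([dominant_diagonal_free]).  On the other hand, they are
    combinations of few monomials ([card_exponents]): if [k] is a coordinate on
    axis [j], then the [m] variables of index [(j, k)] occur with total degree
    at most the number [D] of grid points whose [j]-th coordinate is [k], and
    [m] is a small fraction of [D].  Keeping track of the degree separately
    for every [(j, k)] is essential: a count by total degree loses a
    logarithm. *)

Set Implicit Arguments.
Unset Strict Implicit.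
Unset Printing Implicit Defensive.

Import Order.TTheory GRing.Theory Num.Theory.
Local Open Scope ring_scope.

(** * Small Hamming balls *)

Definition symdiff (T : finType) (A B : {set T}) := (A :\: B) :|: (B :\: A).

Lemma symdiffK (T : finType) (A : {set T}) : involutive (symdiff A).
Proof. by move=> B; apply/setP => x; rewrite !inE; do 2?case: (x \in _). Qed.

Lemma symdiffC (T : finType) (A B : {set T}) : symdiff A B = symdiff B A.
Proof. by rewrite /symdiff setUC. Qed.

Lemma symdiffxx (T : finType) (A : {set T}) : symdiff A A = set0.
Proof. by rewrite /symdiff setDv setU0. Qed.

Definition ball_size (T : finType) (r : nat) :=
  #|[set A : {set T} | (#|A| <= r)%N]|.

Lemma ball_size_le (T : finType) (r s : nat) :
  (r <= s)%N -> (ball_size T r <= ball_size T s)%N.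
Proof.
move=> rs; apply: subset_leq_card; apply/fintype.subsetP => A.
by rewrite !inE => /leq_trans; apply.
Qed.

Lemma card_ball (T : finType) (A : {set T}) (r : nat) :
  #|[set B | (#|symdiff A B| <= r)%N]| = ball_size T r.
Proof.
rewrite -(card_imset [set B | (#|symdiff A B| <= r)%N] (can_inj (symdiffK A))).
apply: eq_card => B; rewrite inE; apply/imsetP/idP => [[C]|Br].
  by rewrite inE => Cr ->.
by exists (symdiff A B); rewrite ?inE symdiffK.
Qed.

(** Give the set [A] the weight [b.+1 ^ (#|T| - #|A|)]: all the weights sum up
    to [b.+2 ^ #|T|], and every set in the ball has a large weight. *)
Lemma ball_size_expn (T : finType) (r b : nat) : (r <= #|T|)%N ->
  (ball_size T r * b.+1 ^ (#|T| - r) <= b.+2 ^ #|T|)%N.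
Proof.
move=> rT.
have -> : (b.+2 ^ #|T| = \sum_(A : {set T}) b.+1 ^ (#|T| - #|A|))%N.
  transitivity (\prod_(i : T) (1 + b.+1))%N; first by rewrite prod_nat_const.
  rewrite bigA_distr; apply: eq_bigr => A _.
  rewrite (bigID (mem A))/= big1 ?mul1n; last by move=> i ->.
  rewrite (eq_bigr (fun=> b.+1)) => [|i /negPf ->//].
  by rewrite prod_nat_const -(cardC (mem A)) addKn.
rewrite /ball_size -sum_nat_const.
rewrite [X in (_ <= X)%N](bigID [pred A : {set T} | #|A| <= r]%N)/=.
apply: leq_trans (leq_addr _ _); under eq_bigl do rewrite inE.
by apply: leq_sum => A Ar; apply: leq_pexp2l => //; exact: leq_sub2l.
Qed.

(** Bernoulli's inequality for [(1 - 1 / (b + 1)) ^ n], cleared of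
    denominators. *)
Lemma expn_succ_le (b n : nat) : (0 < b)%N -> (2 * n <= b)%N ->
  (b.+1 ^ n <= 2 * b ^ n)%N.
Proof.
move=> b0 nb; have h k : (k <= b)%N -> (b.+1 ^ k * (b - k) <= b ^ k * b)%N.
  elim: k => [|k IH] kb; first by rewrite !expn0 subn0.
  apply: leq_trans (_ : (b.+1 ^ k * (b - k) * b <= _)%N); last first.
    by rewrite (expnS b k) (mulnC b) leq_mul2r IH ?orbT// ltnW.
  rewrite (expnS b.+1 k) [(b.+1 * _)%N]mulnC -!mulnA leq_mul2l; apply/orP; right.
  by have [c ->] : exists c, b = (c + k.+1)%N; [exists (b - k.+1)%N; lia | nia].
rewrite -(@leq_pmul2r b)//.
apply: leq_trans (_ : (2 * (b.+1 ^ n * (b - n)) <= _)%N).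
  by rewrite mulnCA leq_mul2l; apply/orP; right; lia.
by rewrite -mulnA leq_mul2l/=; apply: h; lia.
Qed.

(** Instance of [ball_size_expn] with base [16]: as [17 ^ 8 <= 2 * 16 ^ 8], the
    eighth power of the volume is at most [2 ^ #|T| * 16 ^ (8 * r)]. *)
Lemma ball_size_small (T : finType) (r : nat) : (32 * r <= #|T|)%N ->
  (ball_size T r ^ 4 <= 2 ^ #|T|)%N.
Proof.
move=> rT; have rT' : (r <= #|T|)%N by lia.
(* An opaque [b] keeps the powers of 16 from being evaluated in unary. *)
have [b Eb] : exists b, b.+1 = (2 ^ 4)%N by exists 15%N.
have h : (ball_size T r * b.+1 ^ #|T| <= b.+2 ^ #|T| * b.+1 ^ r)%N.
  by rewrite -{1}(subnK rT') expnD mulnA leq_mul2r ball_size_expn ?orbT.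
have q : (b.+2 ^ 8 <= 2 * b.+1 ^ 8)%N by apply: expn_succ_le => //; rewrite Eb.
rewrite -(@leq_exp2r _ _ 2)// -!expnM -(@leq_pmul2r (b.+1 ^ (8 * #|T|))) ?expn_gt0//.
have -> : (ball_size T r ^ (4 * 2) * b.+1 ^ (8 * #|T|) =
    (ball_size T r * b.+1 ^ #|T|) ^ 8)%N by rewrite expnMn -expnM [(#|T| * 8)%N]mulnC.
apply: leq_trans (_ : ((b.+2 ^ #|T| * b.+1 ^ r) ^ 8 <= _)%N); first by rewrite leq_exp2r.
rewrite expnMn -!expnM [(#|T| * 8)%N]mulnC expnM.
apply: leq_trans (_ : ((2 * b.+1 ^ 8) ^ #|T| * 2 ^ #|T| <= _)%N).
  apply: leq_mul; first by case: #|T| => // n; rewrite leq_exp2r.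
  by rewrite Eb -expnM leq_pexp2l//; lia.
by rewrite expnMn -expnM mulnAC -expnD muln2 addnn.
Qed.

(** * Separated families, bounded exponents and linear dependence *)

Definition separated (T : finType) (r : nat) (E : {set {set T}}) :=
  [forall A in E, forall B in E, (A != B) ==> (r < #|symdiff A B|)%N].

Lemma separatedP (T : finType) (r : nat) (E : {set {set T}}) :
  reflect {in E &, forall A B, A != B -> (r < #|symdiff A B|)%N} (separated r E).
Proof.
apply: (iffP forall_inP) => [h A B AE BE /(implyP (forall_inP (h A AE) B BE))//|h A AE].
by apply/forall_inP => B BE; apply/implyP; exact: h.
Qed.

(** Gilbert-Varshamov: by maximality, the balls of radius [r] around the members
    of a maximal separated subfamily cover [X]. *)
Lemma exists_separated (T : finType) (r : nat) (X : {set {set T}}) :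
  exists E : {set {set T}}, [/\ E \subset X, separated r E
    & (#|X| <= #|E| * ball_size T r)%N].
Proof.
pose P (E : {set {set T}}) := (E \subset X) && separated r E.
have P0 : P set0 by rewrite /P sub0set; apply/separatedP => A B; rewrite inE.
have [E /maxsetP[/andP[EX /separatedP Es] Emax] _] := maxset_exists P0.
exists E; split=> //; first exact/separatedP.
have cov : X \subset \bigcup_(A in E) [set B | (#|symdiff A B| <= r)%N].
  apply/fintype.subsetP => B BX; apply/bigcupP.
  case: (boolP [exists A in E, (#|symdiff A B| <= r)%N]) => [/exists_inP[A AE Ar]|].
    by exists A => //; rewrite inE.
  rewrite negb_exists_in => /forall_inP far.
  have far' A : A \in E -> (r < #|symdiff A B|)%N by move=> /far; rewrite -ltnNge.
  exists B; last by rewrite inE symdiffxx cards0.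
  rewrite -(Emax (B |: E)) ?setU11 ?subsetU1//; apply/andP; split.
    by rewrite subUset sub1set BX.
  apply/separatedP => A C; rewrite !inE => /orP[/eqP->|AE] /orP[/eqP->|CE].
  - by rewrite eqxx.
  - by rewrite symdiffC => _; exact: far'.
  - by move=> _; exact: far'.
  - exact: Es.
rewrite -sum_nat_const; apply: leq_trans (subset_leq_card cov) _.
apply: leq_trans
  (_ : (\sum_(A in E) #|[set B | (#|symdiff A B| <= r)%N]| <= _)%N); last first.
  by apply: leq_sum => A _; rewrite card_ball.
elim/big_rec2: _ => [|A n U _ h]; first by rewrite cards0.
by apply: leq_trans (leq_card_setU _ _) _; rewrite leq_add2l.
Qed.

Lemma pigeonhole_card (X Y : finType) (f : X -> Y) (S : {set Y}) :
  (forall x, f x \in S) -> (0 < #|X|)%N ->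
  exists y, (#|X| <= #|[set x | f x == y]| * #|S|)%N.
Proof.
move=> fS X0; have [x0 _] : exists x0 : X, true.
  by case/card_gt0P: X0 => x0 _; exists x0.
pose F y := #|[set x | f x == y]|.
exists [arg max_(y > f x0 in S) F y]; case: arg_maxnP => [|y yS ymax]; first exact: fS.
rewrite mulnC -sum_nat_const.
apply: (@leq_trans (\sum_(z in S) F z)%N); last exact: leq_sum.
rewrite -sum1_card (partition_big f (mem S))/=; last by move=> x _; exact: fS.
apply: leq_sum => z _; rewrite /F -sum1_card.
by under [X in (_ <= X)%N]eq_bigl do rewrite inE.
Qed.

(** Chernoff's bound: with [x = b / (b + 1)], every exponent of degree at most
    [D] has weight [x ^ (\sum_s e s) >= x ^ D], while the weights of all the
    exponents sum up to at most [(1 / (1 - x)) ^ m = (b + 1) ^ m]. *)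
Lemma card_bounded_exponents (m N D b : nat) : (0 < b)%N ->
  (#|[set e : {ffun 'I_m -> 'I_N.+1} | (\sum_s e s <= D)%N]| * b ^ D
     <= b.+1 ^ (D + m))%N.
Proof.
move=> b0; pose x : rat := b%:R / b.+1%:R.
have b1 : (b.+1%:R : rat) != 0 by rewrite pnatr_eq0.
have x0 : 0 <= x by rewrite divr_ge0 ?ler0n.
have x1 : x <= 1 by rewrite ler_pdivrMr ?ltr0n// mul1r ler_nat.
have geom : \sum_(i < N.+1) x ^+ i <= b.+1%:R.
  have E := subrX1 x N.+1.
  have -> : \sum_(i < N.+1) x ^+ i = (1 - x ^+ N.+1) * b.+1%:R.
    rewrite -opprB E -mulNr opprB mulrAC.
    have -> : (1 - x) * b.+1%:R = 1.
      by rewrite mulrBl mul1r /x mulfVK// -natrB// subSnn.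
    by rewrite mul1r.
  by rewrite ler_piMl ?ler0n// gerBl exprn_ge0.
rewrite -(ler_nat rat) natrM !natrX.
have -> : b%:R = x * b.+1%:R :> rat by rewrite /x mulfVK.
rewrite exprMn exprD [b.+1%:R ^+ D * _]mulrC mulrA ler_wpM2r ?exprn_ge0 ?ler0n//.
apply: (@le_trans _ _ ((\sum_(i < N.+1) x ^+ i) ^+ m)); last first.
  by rewrite lerXn2r ?nnegrE ?sumr_ge0// => i _; exact: exprn_ge0.
have -> : (\sum_(i < N.+1) x ^+ i) ^+ m = \prod_(s < m) \sum_(i < N.+1) x ^+ i.
  by rewrite prodr_const card_ord.
rewrite bigA_distr_bigA/=.
rewrite mulr_natl -sumr_const.
rewrite [X in _ <= X](bigID [pred e : {ffun 'I_m -> 'I_N.+1} | \sum_s e s <= D]%N)/=.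
rewrite -[X in X <= _]addr0 lerD//; last first.
  by apply: sumr_ge0 => e _; apply: prodr_ge0 => i _; exact: exprn_ge0.
under eq_bigl do rewrite inE.
by apply: ler_sum => e eD; rewrite prodrXr; exact: ler_wiXn2l.
Qed.

Lemma exists_dependence (F : fieldType) (X Y : finType) (E : {set X}) (L : {set Y})
    (A : X -> Y -> F) : (#|L| < #|E|)%N ->
  exists2 a : X -> F, exists2 x, x \in E & a x != 0
    & forall y, y \in L -> \sum_(x in E) a x * A x y = 0.
Proof.
move=> LE; pose M := \matrix_(i < #|E|, j < #|L|) A (enum_val i) (enum_val j).
have : kermx M != 0.
  rewrite -mxrank_eq0 mxrank_ker -lt0n subn_gt0.
  exact: leq_ltn_trans (rank_leq_col M) LE.
case/rowV0Pn => v /sub_kermxP vM /rV0Pn[i vi].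
have [x0 x0E] : exists x0, x0 \in E by apply/card_gt0P; apply: leq_trans LE.
exists (fun x => v 0 (enum_rank_in x0E x)).
  by exists (enum_val i); rewrite ?enum_valP// enum_valK_in.
move=> y yL; have /matrixP/(_ 0 (enum_rank_in yL y)) := vM.
rewrite !mxE => s0; rewrite -[RHS]s0.
rewrite (reindex_omap (enum_val : 'I_#|E| -> X)
  (fun x => Some (enum_rank_in x0E x)))/=; last first.
  by move=> x xE; rewrite enum_rankK_in.
apply: eq_big => [j|j _]; first by rewrite enum_valP enum_valK_in eqxx.
by rewrite mxE enum_valK_in enum_rankK_in.
Qed.

(** * Monomials in the entries of the factors of a tensor *)

Section tensor_expansion.
Variables (R : comNzRingType) (d m : nat) (G K : finType) (p : 'I_d -> G -> K).

Definition tensor_value (u : 'I_d -> 'I_m -> K -> R) (g : G) : R :=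
  \sum_(s < m) \prod_(j < d) u j s (p j g).

Definition fibre (q : 'I_d * K) : {set G} := [set g | p q.1 g == q.2].

(** The degrees are recorded block by block, a block [(j, k)] gathering the [m]
    variables [u j s k]: the proof rests on a bound for the degree of each
    block. *)
Definition exponent := {ffun 'I_d * K -> {ffun 'I_m -> 'I_#|G|.+1}}.

Definition exponents : {set exponent} :=
  [set e : exponent | [forall q, (\sum_s e q s <= #|fibre q|)%N]].

Definition monomial (e : exponent) (u : 'I_d -> 'I_m -> K -> R) : R :=
  \prod_q \prod_s u q.1 s q.2 ^+ e q s.

(** Expanding a product of tensor values amounts to choosing, at every point
    [g], either a constant ([None]) or the rank-one term number [s]
    ([Some s]). *)
Definition choice_exponent (c : {ffun G -> option 'I_m}) : exponent :=
  [ffun q => [ffun s => inord #|[set g in fibre q | c g == Some s]|]].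

Lemma choice_exponentE c q s :
  choice_exponent c q s = #|[set g in fibre q | c g == Some s]| :> nat.
Proof. by rewrite !ffunE inordK// ltnS max_card. Qed.

Lemma choice_exponent_in c : choice_exponent c \in exponents.
Proof.
rewrite inE; apply/forallP => q.
under eq_bigr do rewrite choice_exponentE -sum1_card.
under eq_bigr do under eq_bigl do rewrite inE.
under eq_bigr do rewrite big_mkcondr/=.
rewrite exchange_big/= -sum1_card; apply: leq_sum => g _.
case: (c g) => [s|]; last by rewrite big1.
rewrite (bigD1 s)//= eqxx big1 // => i /negPf is_.
by rewrite (inj_eq (@Some_inj _)) eq_sym is_.
Qed.

Lemma prod_choice_monomial (u : 'I_d -> 'I_m -> K -> R) (c : {ffun G -> option 'I_m}) :
  \prod_g oapp (fun s => \prod_j u j s (p j g)) 1 (c g)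
    = monomial (choice_exponent c) u.
Proof.
transitivity (\prod_g \prod_q \prod_s
    (if (p q.1 g == q.2) && (c g == Some s) then u q.1 s q.2 else 1)).
  apply: eq_bigr => g _; rewrite exchange_big/=.
  transitivity (\prod_s (if c g == Some s then \prod_j u j s (p j g) else 1)).
    case: (c g) => [s|]/=; last by rewrite big1.
    rewrite [RHS](bigD1 s)//= eqxx [X in _ * X]big1 ?mulr1 // => i /negPf is_.
    by rewrite (inj_eq (@Some_inj _)) eq_sym is_.
  apply: eq_bigr => s _; case: eqP => _; last first.
    by rewrite big1 // => q _; rewrite andbF.
  under [RHS]eq_bigr do rewrite andbT.
  rewrite -(pair_bigA _ (fun j k => if p j g == k then u j s k else 1))/=.
  apply: eq_bigr => j _; rewrite (bigD1 (p j g))//= eqxx big1 ?mulr1// => k.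
  by rewrite eq_sym => /negPf ->.
rewrite exchange_big; apply: eq_bigr => q _; rewrite exchange_big; apply: eq_bigr => s _.
rewrite choice_exponentE -big_mkcond/= prodr_const; congr (_ ^+ _).
by apply: eq_card => g; rewrite !inE.
Qed.

(** The monomial produced by a choice depends only on the associated exponent,
    and the degree in the block [(j, k)] is bounded by the number of points
    that involve this block. *)
Lemma prod_affine_expansion (a b : G -> R) :
  exists c : exponent -> R, forall u,
    \prod_g (a g + b g * tensor_value u g) = \sum_(e in exponents) c e * monomial e u.
Proof.
exists (fun e => \sum_(c : {ffun G -> option 'I_m} | choice_exponent c == e)
  \prod_g oapp (fun=> b g) (a g) (c g)) => u.
transitivity (\prod_g \sum_(o : option 'I_m)
    oapp (fun=> b g) (a g) o * oapp (fun s => \prod_j u j s (p j g)) 1 o).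
  apply: eq_bigr => g _; rewrite (bigD1 None)//= mulr1; congr (_ + _).
  rewrite /tensor_value big_distrr/= (reindex_omap Some id)//=; last by case.
  by apply: eq_bigl => s; rewrite eqxx.
rewrite bigA_distr_bigA/= (partition_big choice_exponent (mem exponents))/=; last first.
  by move=> c _; exact: choice_exponent_in.
apply: eq_bigr => e _; rewrite big_distrl/=; apply: eq_bigr => c /eqP <-.
by rewrite big_split/= prod_choice_monomial.
Qed.

(** The number of exponents is a product over the blocks.  A block that meets
    [D > 0] points contributes at most [2 ^ (D / (4 * d))], because [m] is at
    most [D / (128 * d ^ 2)], and for each [j] the fibres over the coordinates
    [k] partition [G]. *)
Lemma card_exponents : (0 < d)%N ->
  (forall j g, (128 * d ^ 2 * m <= #|fibre (j, p j g)|)%N) ->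
  (#|exponents| ^ 4 <= 2 ^ #|G|)%N.
Proof.
move=> d0 Dm.
pose cnt q := #|[set e : {ffun 'I_m -> 'I_#|G|.+1} | (\sum_s e s <= #|fibre q|)%N]|.
have cntE : #|exponents| = (\prod_q cnt q)%N.
  transitivity #|family (fun q => [pred e : {ffun 'I_m -> 'I_#|G|.+1} |
      (\sum_s e s <= #|fibre q|)%N])|.
    by apply: eq_card => e; rewrite inE; apply/forallP/familyP.
  rewrite card_family foldrE big_map big_enum/=; apply: eq_bigr => q _.
  by apply: eq_card => e; rewrite inE.
have cnt_le q : (cnt q ^ (4 * d) <= 2 ^ #|fibre q|)%N.
  have [/eqP|] := posnP #|fibre q|.
    move=> /eqP D0; rewrite D0 expn0 -[X in (_ <= X)%N](exp1n (4 * d)).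
    rewrite leq_exp2r ?muln_gt0//.
    rewrite /cnt D0; apply/card_le1_eqP => e1 e2; rewrite !inE.
    rewrite !leqn0 !sum_nat_eq0 => /forall_inP h1 /forall_inP h2.
    apply/ffunP => s; apply/val_inj.
    by rewrite /= (eqP (h1 s isT)) (eqP (h2 s isT)).
  move=> /card_gt0P[g]; rewrite inE => /eqP pg.
  have := Dm q.1 g; rewrite pg -surjective_pairing => {}Dm.
  (* With [b = 16 * d] both factors [(b.+1 / b) ^ (8 * d * D)] and
     [b.+1 ^ (8 * d * m)] are at most [2 ^ D]. *)
  have [b Eb] : exists b, b = (16 * d)%N by eexists.
  have b0 : (0 < b)%N by lia.
  have := card_bounded_exponents m #|G| #|fibre q| b0; rewrite -/(cnt q).
  move: #|fibre q| Dm => D Dm h.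
  have hb : (b.+1 ^ (8 * d) <= 2 * b ^ (8 * d))%N by apply: expn_succ_le => //; lia.
  have hb2 : (b.+1 ^ (8 * d * m) <= 2 ^ D)%N.
    apply: leq_trans (_ : ((2 ^ b) ^ (8 * d * m) <= _)%N).
      by case: (8 * d * m)%N => // k; rewrite leq_exp2r// ltn_expl.
    by rewrite -expnM leq_pexp2l//; nia.
  rewrite -(@leq_exp2r _ _ 2)// -!expnM -(@leq_pmul2r (b ^ (8 * d * D))) ?expn_gt0 ?b0//.
  have -> : (cnt q ^ (4 * d * 2) * b ^ (8 * d * D) = (cnt q * b ^ D) ^ (8 * d))%N.
    by rewrite expnMn -expnM; congr (_ ^ _ * _ ^ _)%N; lia.
  apply: leq_trans (_ : ((b.+1 ^ (D + m)) ^ (8 * d) <= _)%N).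
    by rewrite leq_exp2r ?muln_gt0.
  rewrite -expnM mulnDl expnD [(D * _)%N]mulnC [(m * _)%N]mulnC expnM.
  apply: leq_trans (_ : ((2 * b ^ (8 * d)) ^ D * 2 ^ D <= _)%N).
    by apply: leq_mul => //; case: (D) => // k; rewrite leq_exp2r.
  by rewrite expnMn -expnM mulnAC -expnD muln2 addnn.
rewrite -(@leq_exp2r _ _ d)// -!expnM cntE.
have -> : ((\prod_q cnt q) ^ (4 * d) = \prod_q cnt q ^ (4 * d))%N.
  by elim/big_rec2: _ => [|q x y _ <-]; rewrite ?exp1n// expnMn.
have -> : (#|G| * d = \sum_q #|fibre q|)%N.
  rewrite -(pair_bigA _ (fun j k => #|fibre (j, k)|))/=.
  rewrite -[X in (_ * X)%N]card_ord mulnC -sum_nat_const.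
  apply: eq_bigr => j _; rewrite -sum1_card (partition_big (p j) predT)//=.
  by apply: eq_bigr => k _; rewrite -sum1_card; apply: eq_bigl => g; rewrite inE.
rewrite expn_sum; exact: leq_prod.
Qed.

End tensor_expansion.

(** * A sign pattern far from all tensors of small rank *)

Definition pattern_sign (R : realFieldType) (T : finType) (A : {set T}) (x : T) : R :=
  if x \in A then 1 else -1.

(** Two patterns of the separated family disagree, off the exceptional set, on
    more than a 64th of the points, and each disagreement costs a factor
    [pattern_tol]: the total cost is at most [8^-1 ^+ #|G|], which outweighs
    the number of patterns, at most [2 ^ #|G|]. *)
Definition pattern_tol (R : realFieldType) : R := 8^-1 ^+ 64.

Lemma pattern_tol_gt0 (R : realFieldType) : 0 < pattern_tol R.
Proof. by rewrite exprn_gt0// invr_gt0 ltr0n. Qed.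

Lemma pattern_tol_le (R : realFieldType) : pattern_tol R <= 8^-1.
Proof.
rewrite /pattern_tol exprS ler_piMr ?invr_ge0 ?ler0n//.
by rewrite exprn_ile1 ?invr_ge0 ?ler0n// invf_le1 ?ler1n ?ltr0n.
Qed.

Section sign_selector.
Variables (R : realFieldType) (G : finType) (S : {set G}) (t : R).
Hypotheses (t0 : 0 <= t) (t1 : t <= 1).
Implicit Types (e : {set G}) (v : G -> R).

(** On sign vectors [v], the product [selector e] is the indicator of the event
    that [v] agrees with the pattern [e] outside [S].  The factors at the
    points of [S] are the constant [1] rather than absent, in order that
    [prod_affine_expansion] applies. *)
Definition selector_const (g : G) : R := if g \in S then 1 else 2^-1.
Definition selector_slope e (g : G) : R :=
  if g \in S then 0 else pattern_sign R e g / 2.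
Definition selector e v : R :=
  \prod_g (selector_const g + selector_slope e g * v g).

Lemma selector_diag e v : {in ~: S, forall g, `|v g - pattern_sign R e g| <= 2 * t} ->
  (1 - t) ^+ #|G| <= selector e v.
Proof.
move=> ve; rewrite -prodr_const; apply: ler_prod => g _; rewrite subr_ge0 t1/=.
rewrite /selector_const /selector_slope.
case: ifPn => gS; first by rewrite mul0r addr0 gerBl.
have := ve g; rewrite inE gS ler_norml /pattern_sign => /(_ isT)/andP[].
by case: ifP => _ ? ?; lra.
Qed.

Lemma selector_offdiag e e' v :
  {in ~: S, forall g, `|v g - pattern_sign R e g| <= 2 * t} ->
  `|selector e' v| <= t ^+ #|symdiff e e' :\: S| * (1 + t) ^+ #|G|.
Proof.
move=> ve; rewrite normr_prod -[(1 + t) ^+ _]prodr_const.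
have -> : t ^+ #|symdiff e e' :\: S| =
    \prod_g (if g \in symdiff e e' :\: S then t else 1).
  by rewrite -big_mkcond/= prodr_const.
rewrite -big_split/=.
apply: ler_prod => g _; rewrite normr_ge0/= /selector_const /selector_slope !inE.
case: ifPn => gS /=; first by rewrite mul0r addr0 normr1 mul1r lerDl.
have := ve g; rewrite inE gS ler_norml /pattern_sign => /(_ isT)/andP[].
case: (g \in e); case: (g \in e') => /= h1 h2; rewrite ?mul1r ler_norml;
  apply/andP; split; nra.
Qed.

End sign_selector.

(** A strictly dominant diagonal makes the columns independent: evaluate the
    relation in the row of the coefficient of largest absolute value. *)
Lemma dominant_diagonal_free (R : realFieldType) (X : finType) (E : {set X})
    (a : X -> R) (M : X -> X -> R) (eps delta : R) :
  {in E, forall x, \sum_(y in E) a y * M x y = 0} ->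
  {in E, forall x, delta <= `|M x x|} ->
  {in E &, forall x y, x != y -> `|M x y| <= eps} ->
  0 <= eps -> #|E|%:R * eps < delta -> {in E, forall x, a x = 0}.
Proof.
move=> aM0 Md Mo e0 ed x0 x0E.
have [x xE amax] : exists2 x, x \in E & forall y, y \in E -> `|a y| <= `|a x|.
  by case: (arg_maxP (fun x => `|a x|) x0E) => x xE h; exists x.
have ax : `|a x| = 0.
  apply/eqP; rewrite eq_le normr_ge0 andbT leNgt; apply/negP => ax0.
  have /eqP := aM0 x xE; rewrite (bigD1 x)//= addr_eq0 => /eqP h.
  have : `|a x| * delta <= `|a x| * (#|E|%:R * eps).
    apply: le_trans (_ : `|a x * M x x| <= _).
      by rewrite normrM ler_pM2l// Md.
    rewrite h normrN; apply: le_trans (ler_norm_sum _ _ _) _.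
    apply: le_trans (_ : \sum_(y in E) `|a x| * eps <= _); last first.
      by rewrite sumr_const -[X in X <= _]mulr_natr mulrAC -mulrA.
    rewrite [X in _ <= X](bigD1 x)//= -[X in X <= _]add0r lerD ?mulr_ge0//.
    apply: ler_sum => y /andP[yE yx]; rewrite normrM ler_pM// ?amax//.
    by rewrite Mo// eq_sym.
  by rewrite ler_pM2l// leNgt ed.
by apply/eqP; rewrite -normr_le0 -ax amax.
Qed.

(** If all patterns could be approximated off few points, the selectors of a
    large separated family of patterns with a common exceptional set would be
    linearly independent by [dominant_diagonal_free], although they are
    combinations of fewer monomials. *)
Lemma exists_inapproximable_pattern (R : realFieldType) (d m : nat) (G K : finType)
    (p : 'I_d -> G -> K) : (0 < d)%N -> (0 < #|G|)%N ->
  (forall j g, (128 * d ^ 2 * m <= #|fibre p (j, p j g)|)%N) ->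
  exists e : {set G}, forall u : 'I_d -> 'I_m -> K -> R,
    (#|G| < 64 * #|[set g | (2 * pattern_tol R <
      `|tensor_value p u g - pattern_sign R e g|)%R]|)%N.
Proof.
move=> d0 G0 Dm; set t := pattern_tol R.
have t0 : 0 < t by exact: pattern_tol_gt0.
have t8 : t <= 8^-1 by exact: pattern_tol_le.
have t0' : 0 <= t by exact: ltW.
have t1 : t <= 1 by lra.
have tE : t = 8^-1 ^+ 64 by [].
clearbody t.
pose bad (e : {set G}) (u : 'I_d -> 'I_m -> K -> R) : {set G} :=
  [set g | 2 * t < `|tensor_value p u g - pattern_sign R e g|].
case: (pselect (exists e, forall u, (#|G| < 64 * #|bad e u|)%N)) => [//|noe].
exfalso; pose r := (#|G| %/ 64)%N.
have [u ubad] : exists u, forall e, (#|bad e (u e)| <= r)%N.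
  apply: (@fin_all_exists _ _ (fun e v => #|bad e v| <= r)%N) => e.
  apply: contra_notP noe => eu; exists e => v; rewrite ltnNge; apply/negP => h.
  by apply: eu; exists v; rewrite leq_divRL// mulnC.
have cardG : #|{set G}| = (2 ^ #|G|)%N.
  by rewrite -(cardsT G) -card_powerset powersetT cardsT.
pose W := ball_size G (2 * r).
have W4 : (W ^ 4 <= 2 ^ #|G|)%N.
  apply: ball_size_small; rewrite mulnA mulnC; exact: leq_trunc_div.
(* Patterns with the same exceptional set [S], among them a separated family. *)
have [S XS] : exists S, (2 ^ #|G| <= #|[set e | bad e (u e) == S]| * ball_size G r)%N.
  rewrite -cardG; apply: (@pigeonhole_card _ _ (fun e => bad e (u e))).
    by move=> e; rewrite inE.
  by rewrite cardG expn_gt0.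
have [E [EX /separatedP Esep XE]] := exists_separated (2 * r) [set e | bad e (u e) == S].
have badE e : e \in E -> bad e (u e) = S.
  by move=> /(fintype.subsetP EX); rewrite inE => /eqP.
have EW : (2 ^ #|G| <= #|E| * W * W)%N.
  apply: leq_trans XS _; apply: leq_mul => //; apply: ball_size_le; lia.
have LE : (#|exponents m p| < #|E|)%N.
  rewrite ltnNge; apply/negP => EL; have L4 := card_exponents d0 Dm.
  have : ((2 ^ #|G|) ^ 4 <= (2 ^ #|G|) ^ 3)%N.
    apply: leq_trans (_ : ((#|exponents m p| * W * W) ^ 4 <= _)%N).
      by rewrite leq_exp2r//; apply: leq_trans EW _; rewrite !leq_mul.
    by rewrite !expnMn -mulnA; do 2?[apply: leq_mul => //].
  by rewrite leqNgt ltn_exp2l// -[X in (X < _)%N](expn0 2) ltn_exp2l// G0.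
(* As there are fewer monomials than members of [E], the selectors are
   dependent. *)
have [c cE] : exists c : {set G} -> exponent d m G K -> R, forall e v,
    selector S e (tensor_value p v) =
    \sum_(l in exponents m p) c e l * monomial l v.
  apply: (@fin_all_exists _ (fun=> exponent d m G K -> R) (fun e ce => forall v,
    selector S e (tensor_value p v) =
    \sum_(l in exponents m p) ce l * monomial l v)) => e.
  exact: prod_affine_expansion.
have [a [e0 e0E ae0] aE] := exists_dependence c LE.
suff /(_ e0 e0E)/eqP : {in E, forall e, a e = 0} by rewrite (negPf ae0).
have close e : e \in E -> {in ~: S, forall g,
    `|tensor_value p (u e) g - pattern_sign R e g| <= 2 * t}.
  by move=> eE g; rewrite -(badE e eE) !inE -leNgt.
apply: (@dominant_diagonal_free _ _ _ _ (fun e e' => selector S e' (tensor_value p (u e)))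
  (t ^+ r.+1 * (1 + t) ^+ #|G|) ((1 - t) ^+ #|G|)).
- move=> e eE; under eq_bigr do rewrite cE mulr_sumr.
  rewrite exchange_big/= big1// => l lL.
  by under eq_bigr do rewrite mulrA; rewrite -mulr_suml aE ?mul0r.
- move=> e eE; apply: le_trans (ler_norm _); exact: selector_diag (close e eE).
- move=> e e' eE e'E ee'; apply: le_trans (selector_offdiag t0' e' (close e eE)) _.
  rewrite ler_wpM2r ?exprn_ge0//; first lra.
  rewrite ler_wiXn2l//.
  (* Discarding [S] leaves [2 * r + 1 - r] of the disagreements. *)
  have Sr : (#|S| <= r)%N by rewrite -(badE e eE).
  have := Esep e e' eE e'E ee'; rewrite -(cardsID S (symdiff e e')).
  have := subset_leq_card (subsetIr (symdiff e e') S).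
  by move: Sr; clear; lia.
- by rewrite mulr_ge0// exprn_ge0//; lra.
have rG : (#|G| <= 64 * r.+1)%N by rewrite mulnC ltnW// ltn_ceil.
have tr : t ^+ r.+1 <= 8^-1 ^+ #|G|.
  by rewrite tE -exprM ler_wiXn2l//; lra.
have E2 : (#|E|%:R : R) <= 2 ^+ #|G|.
  by rewrite -natrX ler_nat -cardG max_card.
apply: (@le_lt_trans _ _ (2 ^+ #|G| * (8^-1 ^+ #|G| * (1 + t) ^+ #|G|))).
  by rewrite ler_pM ?ler0n ?mulr_ge0 ?exprn_ge0// ?ler_wpM2r ?exprn_ge0//; lra.
by rewrite -!exprMn ltrXn2r -?lt0n ?G0//; lra.
Qed.


From mathcomp Require Import complex finmap.
From mathcomp Require Import all_classical all_reals all_analysis.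
From mathcomp Require Import measurable_realfun measurable_fun_approximation.
From mathcomp Require Import ess_sup_inf.
From mathcomp Require Import zify ring lra.

Import numFieldNormedType.Exports.

(** * The Fejer kernel *)

(** Distributivity of a product over sums whose index types vary. *)
Lemma prod_sum_fprod (R : comPzSemiRingType) (I : finType) (T : I -> finType)
    (P : forall i, T i -> R) :
  \prod_i \sum_(x : T i) P i x = \sum_(t : fprod T) \prod_i P i (t i).
Proof.
transitivity (\sum_(t : fprod T) \prod_(i in I) [ffun x => P i x] (t i)); last first.
  by apply: eq_bigr => t _; apply: eq_bigr => i _; rewrite ffunE.
rewrite big_fprod.
transitivity (\prod_i \sum_(j in tagged_with T i) untag 0 [ffun x => P i x] j).
  apply: eq_bigr => i _.
  apply: etrans (big_tag (fun k (x : T k) => [ffun x => P k x] x) i).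
  by apply: eq_bigr => x _; rewrite ffunE.
by rewrite bigA_distr_big_dep.
Qed.

Section fejer.
Variable R : realType.
Implicit Types (Q : nat) (x : R).

Definition fejer Q x : R :=
  Q%:R ^- 2 * \sum_(k < Q) \sum_(l < Q) cos ((k%:R - l%:R) * x).

(** The kernel is the squared modulus of a normalised geometric sum of
    exponentials, hence nonnegative. *)
Lemma fejerE Q x : fejer Q x =
  (Q%:R^-1 * \sum_(k < Q) cos (k%:R * x)) ^+ 2 +
  (Q%:R^-1 * \sum_(k < Q) sin (k%:R * x)) ^+ 2.
Proof.
rewrite !exprMn -mulrDr exprVn; congr (_ * _).
rewrite !expr2 !big_distrl/= -big_split/=; apply: eq_bigr => k _.
rewrite !big_distrr/= -big_split/=; apply: eq_bigr => l _.
by rewrite mulrBl cosB.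
Qed.

Lemma fejer_ge0 Q x : 0 <= fejer Q x.
Proof. by rewrite fejerE addr_ge0// sqr_ge0. Qed.

(** The sum telescopes after multiplication by [2 * sin (b / 2)]. *)
Lemma sum_cos_arith n (a b : R) :
  2 * sin (b / 2) * \sum_(p < n) cos (a - p%:R * b)
    = sin (a + b / 2) - sin (a + b / 2 - n%:R * b).
Proof.
elim: n => [|n IH]; first by rewrite big_ord0 mulr0 mul0r subr0 subrr.
rewrite big_ord_recr/= mulrDr IH -[n.+1%:R]natr1.
have -> : a + b / 2 - n%:R * b = (a - n%:R * b) + b / 2 by ring.
have -> : a + b / 2 - (n%:R + 1) * b = (a - n%:R * b) - b / 2 by field.
by move: (a - n%:R * b) => c; rewrite (sinD c) (sinB c); ring.
Qed.

Lemma sum_cos_roots Q j x : (0 < j < Q)%N ->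
  \sum_(p < Q) cos (j%:R * (x - p%:R * (2 * pi / Q%:R))) = 0.
Proof.
move=> /andP[j0 jQ]; have Q0 : (Q%:R : R) != 0.
  by rewrite pnatr_eq0 -lt0n (leq_ltn_trans _ jQ).
pose b : R := j%:R * (2 * pi / Q%:R).
have sb : sin (b / 2) != 0.
  rewrite gt_eqF// sin_gt0_pi//.
  have -> : b / 2 = pi * (j%:R / Q%:R) by rewrite /b; field.
  have Qp : 0 < Q%:R :> R by rewrite ltr0n (leq_ltn_trans _ jQ).
  apply/andP; split; first by rewrite mulr_gt0 ?pi_gt0// divr_gt0// ltr0n.
  by rewrite gtr_pMr ?pi_gt0// ltr_pdivrMr// mul1r ltr_nat.
have := sum_cos_arith Q (j%:R * x) b.
have -> : j%:R * x + b / 2 - Q%:R * b = j%:R * x + b / 2 - (pi *+ 2) *+ j.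
  by rewrite /b -[pi *+ 2]mulr_natl -[_ *+ j]mulr_natl; field.
have -> : sin (j%:R * x + b / 2 - pi *+ 2 *+ j) = sin (j%:R * x + b / 2).
  by rewrite -(periodicn (@sinD2pi R) j) subrK.
rewrite subrr => /eqP; rewrite mulf_eq0 mulf_eq0 pnatr_eq0/= (negPf sb)/= => /eqP h.
by rewrite -[RHS]h; apply: eq_bigr => p _; congr cos; rewrite /b; ring.
Qed.

(** The frequencies [k - l] of the kernel are smaller than [Q] in absolute value,
    so that only the frequency zero survives the summation over the [Q]
    equispaced nodes. *)
Lemma fejer_partition Q x : (0 < Q)%N ->
  \sum_(p < Q) fejer Q (x - p%:R * (2 * pi / Q%:R)) = 1.
Proof.
move=> Q0; rewrite -big_distrr/= exchange_big/=.
transitivity (Q%:R ^- 2 * \sum_(k < Q) (Q%:R : R)); last first.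
  by rewrite sumr_const card_ord -[(Q%:R *+ Q)]mulr_natr -expr2 mulVf//
    expf_neq0// pnatr_eq0 -lt0n.
congr (_ * _); apply: eq_bigr => k _; rewrite exchange_big/= (bigD1 k)//=.
rewrite [X in _ + X]big1 ?addr0; last first.
  move=> l lk; have [kl|kl|kl] := ltngtP k l; last by rewrite (val_inj kl) eqxx in lk.
    rewrite -[RHS](@sum_cos_roots Q (l - k) x)
      ?subn_gt0 ?kl ?(leq_ltn_trans (leq_subr _ _))//.
    by apply: eq_bigr => p _; rewrite -cosN -mulNr opprB natrB// ltnW.
  rewrite -[RHS](@sum_cos_roots Q (k - l) x)
      ?subn_gt0 ?kl ?(leq_ltn_trans (leq_subr _ _))//.
  by apply: eq_bigr => p _; rewrite natrB// ltnW.
under eq_bigr do rewrite subrr mul0r cos0.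
by rewrite sumr_const card_ord.
Qed.

(** All the frequencies are at most [Q], so on an interval of length [b / Q] every
    cosine is close to [1], uniformly in [Q]. *)
Lemma fejer_near0 (e : R) : 0 < e -> exists2 b : R, 0 < b <= 1 &
  forall Q x, (0 < Q)%N -> 0 <= x -> x * Q%:R <= b -> 1 - e <= fejer Q x.
Proof.
move=> e0; have /cvgrPdist_le/(_ (e / 2)) := @continuous_cos R 0.
rewrite divr_gt0//= cos0 => /(_ isT)/nbhs_ballP[b /= b0 hb].
exists (Num.min 1 (b / 2)).
  by rewrite ge_min lexx lt_min ltr01 divr_gt0.
move=> Q x Q0 x0 xQb.
have Qp : 0 < Q%:R :> R by rewrite ltr0n.
have cosge (k : 'I_Q) : 1 - e / 2 <= cos (k%:R * x).
  have /hb : ball (0 : R) b (k%:R * x).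
    rewrite /ball/= sub0r normrN ger0_norm ?mulr_ge0//.
    apply: (@le_lt_trans _ _ (x * Q%:R)); first by rewrite mulrC ler_wpM2l// ler_nat ltnW.
    by apply: le_lt_trans xQb _; rewrite gt_min; apply/orP; right; lra.
  by rewrite ler_distl => /andP[_]; lra.
have avg : 1 - e / 2 <= Q%:R^-1 * \sum_(k < Q) cos (k%:R * x).
  rewrite ler_pdivlMl//; apply: (@le_trans _ _ (\sum_(k < Q) (1 - e / 2))).
    by rewrite sumr_const card_ord mulr_natl.
  exact: ler_sum.
have [e2|e2] := lerP e 1; last by apply: (le_trans _ (fejer_ge0 _ _)); lra.
rewrite fejerE; apply: (@le_trans _ _ ((Q%:R^-1 * \sum_(k < Q) cos (k%:R * x)) ^+ 2)).
  by nra.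
by rewrite lerDl sqr_ge0.
Qed.

End fejer.

(** * Closure properties of trigonometric polynomials *)

Section cis.
Variable R : realType.
Local Open Scope complex_scope.
Implicit Types a b : R.

Lemma cisD a b : cis (a + b) = cis a * cis b.
Proof. by rewrite /cis cosD sinD; simpc; congr (_ +i* _); rewrite addrC. Qed.

Lemma cis0 : cis 0 = 1 :> R[i].
Proof. by rewrite /cis cos0 sin0. Qed.

Lemma conj_cis a : conjc (cis a) = cis (- a).
Proof. by rewrite /cis cosN sinN. Qed.

Lemma cos_cis a : (cos a)%:C = (cis a + cis (- a)) / 2.
Proof.
rewrite /cis cosN sinN; apply: (@mulIf _ (2 : R[i])); first by rewrite pnatr_eq0.
by rewrite mulfVK ?pnatr_eq0// mulr_natr mulr2n; simpc.
Qed.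

Lemma cis_sum (I : finType) (a : I -> R) : cis (\sum_i a i) = \prod_i cis (a i).
Proof. by elim/big_rec2: _ => [|i y z _ <-]; rewrite ?cis0 ?cisD. Qed.

Lemma sum_cis (I : finType) (a : I -> R) :
  \sum_i cis (a i) = (\sum_i cos (a i)) +i* (\sum_i sin (a i)).
Proof. by elim/big_rec3: _ => // i x y z _ ->; rewrite /cis; simpc. Qed.

(** A sum of exponentials is multiplicative in the phases; that the sine sums
    vanish says that every factor is already a sum of exponentials. *)
Lemma prod_sum_cos (I : finType) (T : I -> finType) (a : forall i, T i -> R) :
  (forall i, \sum_(t : T i) sin (a i t) = 0) ->
  \prod_i \sum_(t : T i) cos (a i t) =
  \sum_(q : fprod T) cos (\sum_i a i (q i)).
Proof.
move=> sin0; suff /(congr1 (@complex.Re R)) : (\prod_i \sum_(t : T i) cos (a i t))%:C =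
    \sum_(q : fprod T) cis (\sum_i a i (q i)) by rewrite sum_cis.
rewrite rmorph_prod/=.
under eq_bigr => i _.
  rewrite (_ : (\sum_(t : T i) cos (a i t))%:C = \sum_(t : T i) cis (a i t)); first over.
  by rewrite sum_cis sin0.
by rewrite prod_sum_fprod; apply: eq_bigr => q _; rewrite cis_sum.
Qed.

End cis.

Lemma finite_spectrum (d : nat) (n : 'I_d -> nat) : finite_set (spectrum n).
Proof.
pose B := (\sum_j n j)%N.
pose h (e : {ffun 'I_d -> 'I_(B.*2.+1)}) : {ffun 'I_d -> int} :=
  [ffun j => (e j)%:Z - B%:Z].
apply: (@sub_finite_set _ _ (h @` setT)); last exact: finite_image.
move=> k kn; exists [ffun j => inord (absz (k j + B%:Z)%R)] => //.
apply/ffunP => j; rewrite !ffunE.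
have nB : (n j <= B)%N by rewrite /B (bigD1 j)//= leq_addr.
have := kn j; rewrite ler_norml => /andP[k1 k2].
have kB : 0 <= k j + B%:Z.
  by rewrite -lerBlDr sub0r; apply: le_trans k1; rewrite lerN2 lez_nat.
rewrite inordK; first by rewrite gez0_abs// addrK.
rewrite ltnS -lez_nat gez0_abs// -addnn PoszD lerD2r; apply: le_trans k2 _.
by rewrite lez_nat.
Qed.

Section trig_poly.
Variables (R : realType) (d : nat) (n : 'I_d -> nat).
Local Open Scope complex_scope.
Implicit Types (t : euclid R d -> R).

Lemma trig_poly0 : trig_poly n (fun=> 0 : R).
Proof.
by exists (fun=> 0) => [k|x]; rewrite ?conjc0// fsbig1// => k _; rewrite mul0r.
Qed.

Lemma trig_polyD t1 t2 : trig_poly n t1 -> trig_poly n t2 ->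
  trig_poly n (fun x => t1 x + t2 x).
Proof.
move=> [c1 c1N t1E] [c2 c2N t2E]; exists (fun k => c1 k + c2 k) => [k|x].
  by rewrite c1N c2N rmorphD.
rewrite rmorphD/= t1E t2E !(fsbig_finite _ _ (finite_spectrum n)) -big_split/=.
by apply: eq_bigr => k _; rewrite mulrDl.
Qed.

Lemma trig_polyZ (a : R) t : trig_poly n t -> trig_poly n (fun x => a * t x).
Proof.
move=> [c cN tE]; exists (fun k => a%:C * c k) => [k|x].
  by rewrite cN rmorphM/= oppr0.
rewrite rmorphM/= tE !(fsbig_finite _ _ (finite_spectrum n)) big_distrr/=.
by apply: eq_bigr => k _; rewrite mulrA.
Qed.

Lemma trig_poly_sum (I : finType) (a : I -> R) (t : I -> euclid R d -> R) :
  (forall i, trig_poly n (t i)) -> trig_poly n (fun x => \sum_i a i * t i x).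
Proof.
move=> tn; elim: (index_enum I) => [|i s IH].
  by under eq_fun do rewrite big_nil; exact: trig_poly0.
by under eq_fun do rewrite big_cons; apply: trig_polyD => //; exact: trig_polyZ.
Qed.

(** The coefficients are half of [cis (- phi)] at [w] and half of [cis phi] at
    [- w]; they have to be added up when [w = 0]. *)
Lemma trig_poly_cos (w : {ffun 'I_d -> int}) (phi : R) : spectrum n w ->
  trig_poly n (fun x => cos (\sum_j (w j)%:~R * tnth x j - phi)).
Proof.
move=> wn; have Nwn : spectrum n (- w) by move=> j; rewrite ffunE normrN; exact: wn.
pose c k : R[i] := ((k == w)%:R * cis (- phi) + (k == - w)%:R * cis phi) / 2.
exists c => [k|x].
  have conjM (y z : R[i]) : conjc (y * z) = conjc y * conjc z by exact: rmorphM.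
  have conjD (y z : R[i]) : conjc (y + z) = conjc y + conjc z by exact: rmorphD.
  rewrite /c conjM conjD !conjM !conj_cis opprK !conjc_nat conjc_inv conjc_nat.
  by rewrite eqr_oppLR eqr_opp addrC.
have pick u (v : R[i]) F : spectrum n u ->
    \sum_(k <- fset_set (spectrum n)) (k == u)%:R * v * F k = v * F u.
  move=> un; rewrite (bigD1_seq u) ?fset_uniq//=; last first.
    by rewrite in_fset_set; [exact: mem_set|exact: finite_spectrum].
  by rewrite eqxx mul1r big1 ?addr0// => k /negPf ->; rewrite !mul0r.
rewrite (fsbig_finite _ _ (finite_spectrum n)) /c.
transitivity ((\sum_(k <- fset_set (spectrum n)) ((k == w)%:R * cis (- phi) *
   cis (\sum_(j < d) (k j)%:~R * tnth x j)) + \sum_(k <- fset_set (spectrum n))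
   ((k == - w)%:R * cis phi * cis (\sum_(j < d) (k j)%:~R * tnth x j))) / 2).
  rewrite !pick// -!cisD.
  have -> : \sum_(j < d) ((- w) j)%:~R * tnth x j = - \sum_(j < d) (w j)%:~R * tnth x j.
    by rewrite -sumrN; apply: eq_bigr => j _; rewrite ffunE rmorphN mulNr.
  by rewrite cos_cis opprB [- phi + _]addrC.
rewrite -big_split/= big_distrl/=; apply: eq_bigr => k _.
by rewrite [RHS]mulrAC [in RHS]mulrDl.
Qed.

End trig_poly.

(** * Interpolation of sign patterns *)

Section interpolation.
Variables (R : realType) (d : nat) (n : 'I_d -> nat).
Hypothesis n_gt0 : forall j, (0 < n j)%N.
Local Notation grid := (fprod (fun j => 'I_(n j))).
Implicit Types (g : grid) (e : {set grid}) (x : euclid R d).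

Definition node (Q p : nat) : R := - pi + p%:R * (2 * pi / Q%:R).

Definition bump g x : R := \prod_j fejer (n j) (tnth x j - node (n j) (g j)).

Definition interpolant e x : R := \sum_g pattern_sign R e g * bump g x.

Lemma sum_sin_diff Q (y : R) :
  \sum_(t : 'I_Q * 'I_Q) sin ((t.1%:R - t.2%:R) * y) = 0.
Proof.
rewrite -(pair_bigA _ (fun k l : 'I_Q => sin ((k%:R - l%:R) * y)))/=.
set S := \sum_i _; suff : S = - S by lra.
rewrite /S {2}exchange_big/= -sumrN; apply: eq_bigr => k _.
rewrite -sumrN; apply: eq_bigr => l _.
by rewrite -sinN -mulNr opprB.
Qed.

(** The product of the kernels is a sum of cosines of multivariate phases whose
    frequencies are differences of indices below [n j]. *)
Lemma trig_poly_bump g : trig_poly n (bump g).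
Proof.
pose w (q : fprod (fun j => ('I_(n j) * 'I_(n j))%type)) : {ffun 'I_d -> int} :=
  [ffun j => (q j).1%:Z - (q j).2%:Z].
have -> : bump g = fun x => (\prod_j (n j)%:R ^- 2) *
    \sum_q 1 * cos (\sum_j (w q j)%:~R * tnth x j -
      \sum_j (w q j)%:~R * node (n j) (g j)).
  apply/funext => x; rewrite /bump big_split/=; congr (_ * _).
  transitivity (\prod_j \sum_(t : 'I_(n j) * 'I_(n j))
     cos ((t.1%:R - t.2%:R) * (tnth x j - node (n j) (g j)))).
    by apply: eq_bigr => j _; rewrite pair_bigA.
  rewrite prod_sum_cos; last by move=> j; exact: sum_sin_diff.
  apply: eq_bigr => q _; rewrite mul1r -sumrB; congr cos; apply: eq_bigr => j _.
  by rewrite ffunE rmorphB/= mulrBr.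
apply/trig_polyZ/trig_poly_sum => q; apply: trig_poly_cos => j.
rewrite ffunE ler_norml; case: (q j) => -[k kn] [l ln]/=.
by apply/andP; split; lia.
Qed.

Lemma trig_poly_interpolant e : trig_poly n (interpolant e).
Proof. by apply: trig_poly_sum => g; exact: trig_poly_bump. Qed.

Lemma bump_ge0 g x : 0 <= bump g x.
Proof. by apply: prodr_ge0 => j _; exact: fejer_ge0. Qed.

Lemma sum_bump x : \sum_g bump g x = 1.
Proof.
rewrite -(prod_sum_fprod (fun j (p : 'I_(n j)) => fejer (n j) (tnth x j - node (n j) p))).
rewrite big1// => j _; rewrite -[RHS](fejer_partition (tnth x j + pi) (n_gt0 j)).
by apply: eq_bigr => p _; rewrite /node; congr fejer; ring.
Qed.

Lemma pattern_sign_norm e g : `|pattern_sign R e g| = 1.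
Proof. by rewrite /pattern_sign; case: ifP; rewrite ?normrN normr1. Qed.

Lemma interpolant_le1 e x : `|interpolant e x| <= 1.
Proof.
apply: le_trans (ler_norm_sum _ _ _) _; rewrite -(sum_bump x) ler_sum// => g _.
by rewrite normrM pattern_sign_norm mul1r ger0_norm// bump_ge0.
Qed.

(** As the bumps sum up to [1], the error is the sum of
    [(e_g' - e_g) * B_g'], and its term of index [g] vanishes. *)
Lemma interpolant_sign e g x :
  `|interpolant e x - pattern_sign R e g| <= 2 * (1 - bump g x).
Proof.
have -> : interpolant e x - pattern_sign R e g =
    \sum_g' (pattern_sign R e g' - pattern_sign R e g) * bump g' x.
  rewrite /interpolant -[X in _ - X]mulr1 -(sum_bump x) big_distrr/= -sumrB.
  by apply: eq_bigr => g' _; rewrite mulrBl.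
apply: le_trans (ler_norm_sum _ _ _) _.
have -> : 1 - bump g x = \sum_(g' | g' != g) bump g' x.
  by rewrite -(sum_bump x) (bigD1 g)//= addrAC subrr add0r.
rewrite (bigD1 g)//= subrr mul0r normr0 add0r.
rewrite big_distrr/=; apply: ler_sum => g' _.
rewrite normrM (ger0_norm (bump_ge0 _ _)) ler_wpM2r ?bump_ge0//.
by apply: le_trans (ler_normB _ _) _; rewrite !pattern_sign_norm.
Qed.

End interpolation.

(** The size [b] of the neighbourhoods, relative to the mesh, does not depend on
    [n]: this is what makes the final constants depend on the dimension
    only. *)
Lemma interpolant_near (R : realType) (d : nat) (eps : R) : 0 < eps ->
  exists2 b : R, 0 < b <= 1 & forall n : 'I_d -> nat, (forall j, (0 < n j)%N) ->
  forall (e : {set fprod (fun j => 'I_(n j))}) (g : fprod (fun j => 'I_(n j)))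
    (x : euclid R d),
    (forall j, 0 <= tnth x j - node R (n j) (g j) <= b / (n j)%:R) ->
    `|interpolant e x - pattern_sign R e g| <= eps.
Proof.
move=> eps0; pose k := Num.min 1 (eps / (2 * d.+1%:R)).
have k0 : 0 < k by rewrite lt_min ltr01 divr_gt0// mulr_gt0 ?ltr0n.
have k1 : k <= 1 by rewrite ge_min lexx.
have kd : 2 * (d%:R * k) <= eps.
  apply: (@le_trans _ _ (2 * d.+1%:R * k)).
    by rewrite mulrA ler_wpM2r ?(ltW k0)// ler_pM2l// ler_nat.
  by rewrite mulrC -ler_pdivlMr ?mulr_gt0 ?ltr0n// ge_min lexx orbT.
have [b b01 hb] := fejer_near0 k0; exists b => // n n0 e g x xg.
apply: le_trans (interpolant_sign n0 e g x) _; apply: le_trans kd.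
rewrite ler_pM2l// lerBlDr -lerBlDl.
have bern : 1 - d%:R * k <= (1 - k) ^+ d.
  elim: (d) => [|d' IH]; first by rewrite mul0r subr0 expr0.
  rewrite exprS -natr1; have : (1 - k) * (1 - d'%:R * k) <= (1 - k) * (1 - k) ^+ d'.
    by rewrite ler_wpM2l// subr_ge0.
  have : 0 <= d'%:R * k ^+ 2 by rewrite mulr_ge0 ?sqr_ge0.
  by lra.
apply: le_trans bern _; rewrite -[d in X in X <= _]card_ord -prodr_const.
apply: ler_prod => j _; rewrite subr_ge0 k1/=.
have /andP[x0 xb] := xg j; apply: hb => //.
by rewrite -ler_pdivlMr// ltr0n.
Qed.

(** * Translation invariance of the Lebesgue measure *)

Section translation.
Local Open Scope classical_set_scope.
Local Open Scope ring_scope.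
Variable R : realType.
Local Notation gR := (measurableTypeR R).

Definition translate d (c : 'I_d -> R) (x : euclid R d) : euclid R d :=
  [tuple tnth x j + c j | j < d].

Lemma measurable_translate d (c : 'I_d -> R) : measurable_fun setT (translate c).
Proof.
apply/measurable_fun_tnthP => j.
rewrite (_ : _ \o _ = fun x : euclid R d => tnth x j + c j); last first.
  by apply/funext => x /=; rewrite tnth_mktuple.
apply: measurable_funD => //; exact: measurable_tnth.
Qed.

Local Open Scope ereal_scope.

Lemma lebesgue_measure_translate (a : R) (A : set gR) : measurable A ->
  pushforward lebesgue_measure (fun x : gR => (x + a)%R : gR) A = lebesgue_measure A.
Proof.
have ma : measurable_fun setT (fun x : gR => (x + a)%R : gR).
  by apply: measurable_funD.
move=> mA; apply/esym/lebesgue_measure_unique => //= _ [[x y]] _ <-.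
rewrite /pushforward.
have -> : (fun z : gR => (z + a)%R : gR) @^-1` `]x, y]%classic =
    `](x - a)%R, (y - a)%R]%classic.
  by apply/seteqP; split => z /=; rewrite !in_itv/= ltrBlDr lerBrDr.
rewrite !lebesgue_measure_itv/= !lte_fin ltrD2r -!EFinB.
by case: ifP => // _; congr EFin; ring.
Qed.

Lemma ge0_integral_translate1 (a : R) (F : gR -> \bar R) :
  measurable_fun setT F -> (forall x, 0 <= F x) ->
  \int[lebesgue_measure]_x F (x + a)%R = \int[lebesgue_measure]_x F x.
Proof.
move=> mF F0.
have ma : measurable_fun setT (fun x : gR => (x + a)%R : gR).
  by apply: measurable_funD.
transitivity (\int[pushforward lebesgue_measure (fun x : gR => (x + a)%R : gR)]_x F x).
  by rewrite ge0_integral_pushforward.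
by apply: eq_measure_integral => A mA _; exact: lebesgue_measure_translate.
Qed.

Lemma ge0_integral_lebesgue_tupleS d (F : euclid R d.+1 -> \bar R) :
  measurable_fun setT F -> (forall x, 0 <= F x) ->
  \int[lebesgue_tuple d.+1]_x F x =
  \int[lebesgue_measure]_a \int[lebesgue_tuple d]_y F (cons_pair (a, y)).
Proof.
move=> mF F0.
have mFc : measurable_fun setT (F \o @cons_pair R d).
  exact: measurableT_comp mF (@measurable_cons_pair R d).
rewrite -[RHS](@fubini_tonelli1 _ _ _ _ _ _ _ _ mFc)//; last by move=> x; exact: F0.
by rewrite -[RHS](ge0_integral_pushforward (@measurable_cons_pair R d) _ measurableT)//.
Qed.

(** Induction on the dimension, one coordinate at a time by Tonelli's theorem. *)
Lemma ge0_integral_translate d (c : 'I_d -> R) (F : euclid R d -> \bar R) :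
  measurable_fun setT F -> (forall x, 0 <= F x) ->
  \int[lebesgue_tuple d]_x F (translate c x) = \int[lebesgue_tuple d]_x F x.
Proof.
elim: d c F => [|d IH] c F mF F0.
  by apply: eq_integral => x _; congr F; apply: eq_from_tnth => -[].
rewrite !ge0_integral_lebesgue_tupleS//; last first.
  exact: measurableT_comp mF (measurable_translate c).
pose c' (j : 'I_d) := c (lift ord0 j).
have cE a y : translate c (cons_pair (a, y)) = cons_pair ((a + c ord0)%R, translate c' y).
  apply: eq_from_tnth => j; rewrite tnth_mktuple.
  by case: (unliftP ord0 j) => [i|] -> //=; rewrite !tnthS tnth_mktuple.
pose H a := \int[lebesgue_tuple d]_y F (cons_pair (a, y)).
have mFa a : measurable_fun setT (fun y => F (cons_pair (a, y))).
  apply: (measurableT_comp mF).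
  by apply: (measurableT_comp (@measurable_cons_pair R d)); exact: measurable_pair1.
transitivity (\int[lebesgue_measure]_a H (a + c ord0)%R).
  apply: eq_integral => a _; rewrite /H -[RHS](IH c')//.
  by apply: eq_integral => y _; rewrite cE.
apply: ge0_integral_translate1; last by move=> a; exact: integral_ge0.
apply: (@measurable_fun_fubini_tonelli_F _ _ _ _ _
  (lebesgue_tuple d) (F \o @cons_pair R d)) => //.
- exact: measurableT_comp mF (@measurable_cons_pair R d).
- by move=> x; exact: F0.
Qed.

End translation.

(** * A lower bound for the L1 norm over a box *)

Section box.
Local Open Scope classical_set_scope.
Local Open Scope ring_scope.
Variables (R : realType) (d : nat).
Implicit Types (a b l : 'I_d -> R).

Lemma measurable_box a b : measurable (box a b : set (euclid R d)).
Proof.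
rewrite (_ : box a b = \bigcap_(i in [set: 'I_d])
    (fun y : euclid R d => tnth y i) @^-1` `[a i, b i]%classic); last first.
  by apply/seteqP; split => y /= yB i; [move=> _|]; exact: yB.
apply: fin_bigcap_measurable => // i _.
by rewrite -[X in measurable X]setTI; exact: measurable_tnth.
Qed.

Lemma lebesgue_tuple_box a b : (forall i, a i <= b i) ->
  lebesgue_tuple d (box a b) = (\prod_i (b i - a i))%:E.
Proof.
move=> ab; rewrite -[RHS]prodEFin.
apply: etrans (@lebesgue_tuple_prod R d (fun i => `[a i, b i]%classic) _) _ => //.
apply: eq_bigr => i _; rewrite lebesgue_measure_itv/= lte_fin -EFinB.
by have := ab i; rewrite le_eqVlt => /orP[/eqP->|->//]; rewrite ltxx subrr.
Qed.

(** The boxes with sides [l] and corners [v g] are disjoint parts of the big box;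
    translating all of them to the origin puts the values of [h] on the whole
    shifted grid [v] under a single integral. *)
Lemma box_norm1_ge_translates (G : finType) a b l (v : G -> 'I_d -> R)
    (h : euclid R d -> R) (c : R) :
  measurable_fun (box a b) h -> (forall i, 0 <= l i) ->
  (forall g, box (v g) (v g \+ l) `<=` box a b) ->
  trivIset [set: G] (fun g => box (v g) (v g \+ l)) ->
  (forall y, box (fun=> 0) l y -> c <= \sum_g `|h (translate (v g) y)|) ->
  ((c * \prod_i l i)%:E <= box_norm a b 1 h)%E.
Proof.
move=> mh l0 vab vtriv hc; rewrite /box_norm Lnorm1.
set H := fun x => `|((EFin \o h) \_ (box a b)) x|%E.
have mbox := @measurable_box a b.
have mH : measurable_fun setT H.
  have mhr : measurable_fun setT ((EFin \o h) \_ (box a b)).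
    by apply/(measurable_restrictT _ mbox)/measurable_EFinP.
  exact: measurableT_comp mhr.
have H0 x : (0 <= H x)%E by exact: abse_ge0.
pose cell g := box (v g) (v g \+ l); pose cell0 := box (fun=> 0) l.
have mcell g : measurable (cell g) by exact: measurable_box.
have HT g : (\int[lebesgue_tuple d]_(x in cell g) H x =
    \int[lebesgue_tuple d]_(y in cell0) H (translate (v g) y))%E.
  rewrite integral_mkcond -(ge0_integral_translate (v g)); last 2 first.
  - by apply/(measurable_restrictT _ (mcell g)); exact: measurable_funTS.
  - by move=> x; rewrite patchE; case: ifP.
  rewrite [RHS]integral_mkcond; apply: eq_integral => y _; rewrite !patchE.
  congr (if _ then _ else _).
  apply/idP/idP => /set_mem yl; apply/mem_set => i; have := yl i;
    by rewrite tnth_mktuple !in_itv/= => /andP[? ?]; apply/andP; split; lra.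
apply: (@le_trans _ _
  (\sum_(g : G) \int[lebesgue_tuple d]_(x in cell g) H x)%E); last first.
  rewrite -ge0_integral_bigsetU//; last 3 first.
  - exact: index_enum_uniq.
  - by move=> g g' _ _; exact: vtriv.
  - exact: measurable_funTS.
  apply: ge0_subset_integral => //.
  by apply: bigsetU_measurable => g _.
under [X in (_ <= X)%E]eq_bigr do rewrite HT.
rewrite -ge0_integral_sum//; last 2 first.
- exact: measurable_box.
- move=> g; apply: measurable_funTS.
  exact: measurableT_comp mH (measurable_translate _).
rewrite -[X in _ * X](_ : \prod_i (l i - 0) = _); last first.
  by apply: eq_bigr => i _; rewrite subr0.
rewrite EFinM -lebesgue_tuple_box// -integral_cst; last exact: measurable_box.
have [c0|c0] := lerP 0 c; last first.
  apply: (@le_trans _ _ 0%E); last by apply: integral_ge0 => y _; exact: sume_ge0.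
  by rewrite integral_cst; [rewrite mule_le0_ge0// lee_fin ltW|exact: measurable_box].
apply: ge0_le_integral => //.
- exact: measurable_box.
- apply: emeasurable_sum => g; apply: measurable_funTS.
  exact: measurableT_comp mH (measurable_translate _).
move=> y yl; have Hy g : H (translate (v g) y) = `|h (translate (v g) y)|%:E.
  rewrite /H patchE mem_set//; apply: vab => i; move: (yl i).
  by rewrite tnth_mktuple !in_itv/= => /andP[? ?]; apply/andP; split; lra.
under eq_bigr do rewrite Hy.
by rewrite sumEFin lee_fin hc.
Qed.

End box.

Lemma measurable_tensor_sum (R : realType) (d m : nat) (a b : 'I_d -> R)
    (u : 'I_d -> 'I_m -> R -> R) :
  (forall i s, measurable_fun `[a i, b i] (u i s)) ->
  measurable_fun (box a b) (tensor_sum u).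
Proof.
move=> mu; apply: measurable_sum => s; apply: measurable_prod => i _.
apply: (@measurable_comp _ _ _ _ _ _ `[a i, b i]%classic) => //.
- by move=> _ [x xab <-]; exact: xab.
- apply: measurable_funTS; exact: measurable_tnth.
Qed.

Lemma measurable_interpolant (R : realType) (d : nat) (n : 'I_d -> nat)
    (e : {set fprod (fun j => 'I_(n j))}) :
  measurable_fun setT (interpolant e : euclid R d -> R).
Proof.
apply: measurable_sum => g; apply: measurable_funM => //.
apply: measurable_prod => j _; apply: measurable_funM => //.
apply: measurable_sum => k; apply: measurable_sum => l.
apply: (measurableT_comp (f := cos)).
  by apply: continuous_measurable_fun; exact: continuous_cos.
apply: measurable_funM => //; apply: measurable_funB => //; exact: measurable_tnth.
Qed.


(** * The grid of nodes and the lower bound *)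

(** Both sides are products over the axes: a slice has one admissible value on
    axis [j] and all [n i] on the others. *)
Lemma card_fprod_slice (d : nat) (n : 'I_d -> nat) (j : 'I_d) (k : 'I_(n j)) :
  (#|[set g : fprod (fun i => 'I_(n i)) | g j == k]| * n j = \prod_i n i)%N.
Proof.
pose P i (x : 'I_(n i)) := (if i == j then nat_of_bool (x == k :> nat) else 1%N).
have -> : #|[set g : fprod (fun i => 'I_(n i)) | g j == k]| =
    (\prod_i \sum_(x : 'I_(n i)) P i x)%N.
  rewrite [RHS](prod_sum_fprod P) -sum1_card big_mkcond/=.
  apply: eq_bigr => g _; rewrite inE (bigD1 j)//= {1}/P eqxx.
  rewrite big1 ?muln1; first by rewrite -val_eqE; case: eqP.
  by move=> i /negPf ij; rewrite /P ij.
rewrite [in RHS](bigD1 j)//= mulnC; congr (_ * _)%N.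
rewrite (bigD1 j)//= [X in (X * _)%N](_ : _ = 1%N) ?mul1n.
  by apply: eq_bigr => i /negPf ij; rewrite /P ij sum1_card card_ord.
rewrite (bigD1 k)//= /P eqxx eqxx big1// => x /negPf xk.
by rewrite [_ == _ :> nat]xk.
Qed.

Lemma box_norm_infty_le1 (R : realType) (d : nat) (a b : 'I_d -> R)
    (f : euclid R d -> R) : (forall x, `|f x| <= 1) ->
  (box_norm a b +oo f <= 1)%E.
Proof.
move=> f1; rewrite /box_norm unlock; case: ifP => // _.
apply/ess_supP; apply: aeW => x /=; rewrite patchE; case: ifP => _.
  by rewrite lee_fin.
by rewrite abse0.
Qed.

Section nodes.
Variables (R : realType) (d : nat) (n : 'I_d -> nat) (b : R).
Hypothesis n_gt0 : forall j, (0 < n j)%N.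
Hypothesis b01 : 0 < b <= 1.
Local Notation grid := (fprod (fun j => 'I_(n j))).

Let side (j : 'I_d) : R := b / (n j)%:R.
Let corner (g : grid) (j : 'I_d) : R := node R (n j) (g j).

(** The node of index [p] on axis [j] is [- pi + p * (2 * pi / n j)], and the
    side [b / n j] is less than the mesh. *)
Lemma box_node_sub (g : grid) :
  (box (corner g) (corner g \+ side) `<=` box (fun=> - pi) (fun=> pi))%classic.
Proof.
move=> x xg j; move: (xg j); rewrite !in_itv/= /corner /side /node.
have nj : 0 < (n j)%:R :> R by rewrite ltr0n.
have pi2 := pi_ge2 R; have /andP[b0 b1] := b01.
have p0 : 0 <= (g j)%:R * (2 * pi / (n j)%:R) :> R.
  by rewrite mulr_ge0// divr_ge0//; lra.
have p1 : (g j)%:R * (2 * pi / (n j)%:R) + b / (n j)%:R <= 2 * pi :> R.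
  rewrite mulrA -mulrDl ler_pdivrMr//.
  have : (g j)%:R + 1 <= (n j)%:R :> R by rewrite natr1 ler_nat.
  by nra.
by move=> /andP[x1 x2]; apply/andP; split; lra.
Qed.

Lemma trivIset_box_node :
  trivIset [set: grid] (fun g => box (corner g) (corner g \+ side)).
Proof.
move=> g g' _ _ [x [xg xg']]; apply/fprodP => j; apply/val_inj => /=.
have nj : 0 < (n j)%:R :> R by rewrite ltr0n.
have pi2 := pi_ge2 R; have /andP[b0 b1] := b01.
have near (p q : nat) : node R (n j) p <= node R (n j) q + b / (n j)%:R -> (p <= q)%N.
  rewrite /node -addrA lerD2l !mulrA -mulrDl ler_pM2r ?invr_gt0// => pq.
  rewrite leqNgt; apply/negP => qp.
  have : q%:R + 1 <= p%:R :> R by rewrite natr1 ler_nat.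
  by nra.
move: (xg j) (xg' j); rewrite !in_itv/= => /andP[x1 x2] /andP[x3 x4].
by apply/eqP; rewrite eqn_leq !near ?(le_trans x1 x4) ?(le_trans x3 x2).
Qed.

End nodes.

Theorem theorem2 (R : realType) (d : nat) (d_gt0 : (0 < d)%N) :
  exists c1 c2 : R,
    0 < c1 /\ 0 < c2 /\
    forall n : 'I_d -> nat, (forall j, (0 < n j)%N) ->
    forall m : nat,
      m%:R <= c1 * ((\prod_(j < d) n j)%N%:R / (\max_(j < d) n j)%N%:R) ->
      (c2%:E <= Theta_class (fun=> - pi)%R (fun=> pi)%R m 1 (trig_poly_ball n))%E.
Proof.
pose t := pattern_tol R; have t0 : 0 < t by exact: pattern_tol_gt0.
have [b b01 near] := @interpolant_near R d t t0; have /andP[b0 b1] := b01.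
exists (128 * d ^ 2)%N%:R^-1, (t / 64 * b ^+ d).
have C0 : (0 < 128 * d ^ 2)%N by rewrite muln_gt0 expn_gt0 d_gt0.
split; first by rewrite invr_gt0 ltr0n.
split; first by rewrite mulr_gt0 ?exprn_gt0// divr_gt0.
move=> n n0 m; rewrite mulrC ler_pdivlMr ?ltr0n//.
set B := (\max_j n j)%N => mB.
have nB j : (n j <= B)%N by exact: leq_bigmax.
have B0 : (0 < B)%N by apply: leq_trans (nB (Ordinal d_gt0)); exact: n0.
(* The hypothesis on [m] says that every slice of the grid has at least
   [128 * d ^ 2 * m] points, since [n j <= B]. *)
have {}mB : (128 * d ^ 2 * m * B <= \prod_j n j)%N.
  move: mB; rewrite ler_pdivlMr ?ltr0n// -!natrM ler_nat.
  by rewrite [(m * _)%N]mulnC.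
pose G := fprod (fun j => 'I_(n j)).
have cardG : #|{: G}| = (\prod_j n j)%N.
  by rewrite card_fprod; apply: eq_bigr => j _; rewrite card_ord.
(* The coordinates on the different axes are put in one index type. *)
pose p (j : 'I_d) (g : G) : 'I_B.+1 := inord (g j).
have pE j g : p j g = g j :> nat by rewrite inordK// ltnS ltnW// (leq_trans (ltn_ord _)).
have G0 : (0 < #|{: G}|)%N by rewrite cardG prodn_gt0.
have [e he] : exists e : {set G}, forall u : 'I_d -> 'I_m -> 'I_B.+1 -> R,
    (#|{: G}| < 64 * #|[set g |
      (2 * t < `|tensor_value p u g - pattern_sign R e g|)%R]|)%N.
  apply: exists_inapproximable_pattern => // j g.
  rewrite -(leq_pmul2r (n0 j)).
  have -> : fibre p (j, p j g) = [set g' : G | g' j == g j].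
    by apply/setP => g'; rewrite !inE/= -val_eqE/= !pE.
  rewrite (card_fprod_slice (g j)).
  by apply: leq_trans mB; rewrite leq_mul2l nB orbT.
apply: (@le_trans _ _ (Theta (fun=> - pi) (fun=> pi) m 1 (interpolant e))); last first.
  apply: ereal_sup_ubound; exists (interpolant e) => //; split.
    exact: trig_poly_interpolant.
  by apply: box_norm_infty_le1 => x; exact: interpolant_le1.
apply: le_ereal_inf_tmp => _ [u mu <-].
pose l j : R := b / (n j)%:R.
have l0 j : 0 <= l j by rewrite divr_ge0// ltW.
have -> : t / 64 * b ^+ d = t / 64 * #|{: G}|%:R * \prod_j l j.
  rewrite /l big_split/= prodr_const card_ord prodfV -natr_prod -cardG mulrACA.
  by rewrite divff ?mulr1// pnatr_eq0 -lt0n.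
apply: (@box_norm1_ge_translates R d (fprod (fun j => 'I_(n j))) (fun=> - pi) (fun=> pi) l
  (fun g j => node R (n j) (g j)) (interpolant e \- tensor_sum u)) => //.
- apply: measurable_funB; first by apply: measurable_funTS; exact: measurable_interpolant.
  exact: measurable_tensor_sum.
- by move=> g; exact: box_node_sub.
- exact: trivIset_box_node.
move=> y yl; pose v (g : G) := translate (fun j => node R (n j) (g j)) y.
pose u' j s (k : 'I_B.+1) := u j s (tnth y j + node R (n j) k).
have uE g : tensor_sum u (v g) = tensor_value p u' g.
  apply: eq_bigr => s _; apply: eq_bigr => j _.
  by rewrite tnth_mktuple /u' pE.
have fv g : `|interpolant e (v g) - pattern_sign R e g| <= t.
  apply: near => // j; rewrite tnth_mktuple addrK.
  by have := yl j; rewrite in_itv.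
(* Where the tensor misses the sign by [2 * t], it misses the interpolant by
   [t]; this happens at more than a 64th of the nodes. *)
pose bad := [set g | 2 * t < `|tensor_value p u' g - pattern_sign R e g|].
apply: (@le_trans _ _ (\sum_(g in bad) t)).
  rewrite sumr_const -[t *+ _]mulr_natr -mulrA ler_wpM2l ?(ltW t0)//.
  rewrite mulrC ler_pdivrMr// -natrM ler_nat mulnC.
  exact/ltnW/he.
rewrite big_mkcond/=; apply: ler_sum => g _; case: ifPn => // gbad.
move: gbad; rewrite inE => gbad.
rewrite /= -/(v g) uE.
have -> : interpolant e (v g) - tensor_value p u' g =
  (interpolant e (v g) - pattern_sign R e g) -
  (tensor_value p u' g - pattern_sign R e g) by ring.
rewrite distrC; apply: le_trans (lerB_dist _ _).
by have := fv g; lra.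
Qed.
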